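(* Over any field there exist five isotopism classes of six-dimensional filiform Lie algebras, with representatives $$\mathfrak{g}^6_{000},\ \mathfrak{g}^6_{001},\ \mathfrak{g}^6_{010},\ \mathfrak{g}^6_{100} \text{ and }\mathfrak{g}^6_{110}.$$
   Context: A Lie algebra over a field $\mathbb{K}$ has a bilinear bracket with $[u,u]=0$ for all $u$ and satisfying the Jacobi identity. Its lower central series is $\mathcal{C}^1(\mathfrak{g})=\mathfrak{g}$, $\mathcal{C}^k(\mathfrak{g})=[\mathcal{C}^{k-1}(\mathfrak{g}),\mathfrak{g}]$. An $n$-dimensional Lie algebra $\mathfrak{g}$ is filiform if $\dim\mathcal{C}^k(\mathfrak{g})=n-k$ for all $k\in\{2,\ldots,n\}$. Two Lie algebras $\mathfrak{g},\mathfrak{g}'$ over $\mathbb{K}$ are isotopic if there exist three regular (bijective) linear transformations $f,g,h:\mathfrak{g}\to\mathfrak{g}'$ with $[f(u),g(v)]=h([u,v])$ for all $u,v\in\mathfrak{g}$. This is an equivalence relation, whose classes are called isotopism classes. For $a,b,c\in\mathbb{K}$, $\mathfrak{g}^6_{abc}$ is the Lie algebra over $\mathbb{K}$ with basis $\{e_1,\ldots,e_6\}$ and brackets $[e_1,e_{i+1}]=e_i$ for $2\le i\le 5$; $[e_4,e_5]=a e_2$; $[e_4,e_6]=b e_2+a e_3$; $[e_5,e_6]=c e_2+b e_3+a e_4$; brackets of basis vectors not determined by these (via antisymmetry) are zero. *)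

(* Defs.v *)
From HB Require Import structures.
From mathcomp Require Import all_boot all_order all_algebra.
From mathcomp Require Import ring.

Set Implicit Arguments.
Unset Strict Implicit.
Unset Printing Implicit Defensive.

Import GRing.Theory.

Local Open Scope ring_scope.

HB.mixin Record Vector_isLieAlgebra (K : fieldType) L of Vector K L := {
  lie : L -> L -> L;
  lie_linearl : forall v, linear (lie^~ v);
  lie_linearr : forall u, linear (lie u);
  liexx : forall u, lie u u = 0;
  lie_jacobi : forall u v w,
    lie u (lie v w) + lie v (lie w u) + lie w (lie u v) = 0
}.

#[short(type="lieAlgType")]
HB.structure Definition LieAlgebra (K : fieldType) :=
  {L of Vector_isLieAlgebra K L & Vector K L}.

Section LowerCentralSeries.
Variables (K : fieldType) (L : lieAlgType K).
Implicit Types (u v : L) (U V W : {vspace L}).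

(* [U, V] is the span of all brackets [u, v] with u in U and v in V; by
   bilinearity, brackets of basis vectors are enough (see lie_prodvP). *)
Definition lie_prodv U V : {vspace L} :=
  <<[seq lie u v | u <- vbasis U, v <- vbasis V]>>%VS.

Lemma lie_suml v I r (P : pred I) (F : I -> L) :
  lie (\sum_(i <- r | P i) F i) v = \sum_(i <- r | P i) lie (F i) v.
Proof.
have h0 : lie (0 : L) v = 0.
  by have := lie_linearl v (-1) 0 0; rewrite scaleN1r addNr scaleN1r addNr.
apply: (big_morph (fun u => lie u v)) => // x y.
by have := lie_linearl v 1 x y; rewrite !scale1r.
Qed.

Lemma lie_sumr u I r (P : pred I) (F : I -> L) :
  lie u (\sum_(i <- r | P i) F i) = \sum_(i <- r | P i) lie u (F i).
Proof.
have h0 : lie u 0 = 0.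
  by have := lie_linearr u (-1) 0 0; rewrite scaleN1r addNr scaleN1r addNr.
apply: (big_morph (lie u)) => // x y.
by have := lie_linearr u 1 x y; rewrite !scale1r.
Qed.

Lemma lieZl a u v : lie (a *: u) v = a *: lie u v.
Proof.
have := lie_linearl v a u 0; rewrite addr0 => ->.
have -> : lie (0 : L) v = 0.
  by have := lie_suml v [::] xpredT (fun _ : nat => 0); rewrite !big_nil.
by rewrite addr0.
Qed.

Lemma lieZr a u v : lie u (a *: v) = a *: lie u v.
Proof.
have := lie_linearr u a v 0; rewrite addr0 => ->.
have -> : lie u 0 = 0.
  by have := lie_sumr u [::] xpredT (fun _ : nat => 0); rewrite !big_nil.
by rewrite addr0.
Qed.

Lemma lie_prodvP U V W :
  reflect (forall u v, u \in U -> v \in V -> lie u v \in W)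
          (lie_prodv U V <= W)%VS.
Proof.
apply: (iffP idP) => [sUVW u v Uu Vv | sW].
  rewrite (coord_vbasis Uu) (coord_vbasis Vv) lie_suml.
  apply: rpred_sum => i _; rewrite lie_sumr; apply: rpred_sum => j _.
  rewrite lieZl lieZr !rpredZ // (subvP sUVW) // memv_span //.
  by apply/allpairsP; exists ((vbasis U)`_i, (vbasis V)`_j);
     rewrite !mem_nth ?size_tuple.
apply/span_subvP => _ /allpairsP[[u v] /= [Uu Vv ->]].
by rewrite sW ?vbasis_mem.
Qed.

(* Indexed from 1: the value at k = 0 is a dummy, equal to the one at 1. *)
Definition lower_central (k : nat) : {vspace L} :=
  iter k.-1 (fun U => lie_prodv U fullv) fullv.

Definition filiform : Prop :=
  forall k, (2 <= k <= \dim {:L})%N ->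
    \dim (lower_central k) = (\dim {:L} - k)%N.

End LowerCentralSeries.

Arguments filiform {K} L.

Definition isotopic (K : fieldType) (L L' : lieAlgType K) : Prop :=
  exists f g h : {linear L -> L'},
    [/\ bijective f, bijective g, bijective h
      & forall u v, lie (f u) (g v) = h (lie u v)].

Section IsotopicEquivalence.
Variable K : fieldType.
Implicit Types L : lieAlgType K.

Let bij_linear_inv L L' (f : {linear L -> L'}) : bijective f ->
  exists2 g : {linear L' -> L}, cancel f g & cancel g f.
Proof.
case=> g fK gK.
have lg : linear g by move=> a x y; rewrite -[LHS]fK -[RHS]fK linearP !gK.
pose gm := GRing.isLinear.Build K L' L *:%R g lg.
pose gl : {linear L' -> L} := HB.pack g gm.
by exists gl.
Qed.

Lemma isotopic_refl L : isotopic L L.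
Proof. by exists idfun, idfun, idfun; split=> //; exists id. Qed.

Lemma isotopic_sym L L' : isotopic L L' -> isotopic L' L.
Proof.
case=> f [g [h [/bij_linear_inv[f' fK f'K] /bij_linear_inv[g' gK g'K]]]].
move=> /bij_linear_inv[h' hK h'K] fgh; exists f', g', h'.
split; [by exists f | by exists g | by exists h |].
by move=> u v; rewrite -[LHS]hK -fgh f'K g'K.
Qed.

Lemma isotopic_trans L L' L'' :
  isotopic L L' -> isotopic L' L'' -> isotopic L L''.
Proof.
case=> f [g [h [bf bg bh fgh]]] [f' [g' [h' [bf' bg' bh' fgh']]]].
exists (f' \o f), (g' \o g), (h' \o h); split; try exact: bij_comp.
by move=> u v /=; rewrite fgh' fgh.
Qed.

End IsotopicEquivalence.

Section G6.
Variable K : fieldType.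
Implicit Types a b c : K.

(* e_k for 1 <= k <= 6. *)
Definition g6_e (k : nat) : 'rV[K]_6 := delta_mx 0 (inord k.-1).

(* [e_i, e_j] for 1 <= i < j <= 6. *)
Definition g6_table a b c (i j : nat) : 'rV[K]_6 :=
  match i, j with
  | 1%N, 3%N => g6_e 2
  | 1%N, 4%N => g6_e 3
  | 1%N, 5%N => g6_e 4
  | 1%N, 6%N => g6_e 5
  | 4%N, 5%N => a *: g6_e 2
  | 4%N, 6%N => b *: g6_e 2 + a *: g6_e 3
  | 5%N, 6%N => c *: g6_e 2 + b *: g6_e 3 + a *: g6_e 4
  | _, _ => 0
  end.

(* The index i : 'I_6 stands for the basis vector e_(i+1). *)
Definition g6_lie a b c (u v : 'rV[K]_6) : 'rV[K]_6 :=
  \sum_(i < 6) \sum_(j < 6 | (i < j)%N)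
    (u 0 i * v 0 j - u 0 j * v 0 i) *: g6_table a b c i.+1 j.+1.

Lemma g6_eE k (l : 'I_6) : (0 < k <= 6)%N -> g6_e k 0 l = (l.+1 == k)%:R.
Proof. by case: k => // k k6; rewrite mxE -!val_eqE /= inordK. Qed.

Lemma g6_lie_e a b c i j : (1 <= i < j)%N -> (j <= 6)%N ->
  g6_lie a b c (g6_e i) (g6_e j) = g6_table a b c i j.
Proof.
case: i j => [|i] [|j] // /andP[_ ij] j6; rewrite ltnS in ij.
have i6 : (i < 6)%N by apply: ltn_trans ij _.
have E (l l' : 'I_6) : (l < l')%N ->
    g6_e i.+1 0 l * g6_e j.+1 0 l' - g6_e i.+1 0 l' * g6_e j.+1 0 l
    = ((l == Ordinal i6) && (l' == Ordinal j6))%:R.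
  move=> ll'; rewrite !g6_eE // !eqSS -!val_eqE /=.
  have -> : (l' == i :> nat)%:R * (l == j :> nat)%:R = 0 :> K.
    case: eqP => [l'i|_]; last by rewrite mul0r.
    case: eqP => [lj|_]; last by rewrite mulr0.
    by move: ll'; rewrite l'i lj ltnNge ltnW.
  by rewrite subr0 -natrM mulnb.
rewrite /g6_lie (bigD1 (Ordinal i6)) //= (bigD1 (Ordinal j6)) //=.
rewrite E // !eqxx scale1r big1 => [|l /andP[il lj]]; last first.
  by rewrite E // (negPf lj) andbF scale0r.
rewrite addr0 big1 ?addr0 // => l li; apply: big1 => l' ll'.
by rewrite E // (negPf li) scale0r.
Qed.

Fact g6_lie_linearl a b c v : linear ((g6_lie a b c)^~ v).
Proof.
move=> x u w; rewrite /g6_lie scaler_sumr -big_split; apply: eq_bigr => i _ /=.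
rewrite scaler_sumr -big_split; apply: eq_bigr => j _ /=.
by rewrite scalerA -scalerDl !mxE; congr (_ *: _); ring.
Qed.

Fact g6_liexx a b c u : g6_lie a b c u u = 0.
Proof.
rewrite /g6_lie big1 // => i _; rewrite big1 // => j _.
by rewrite mulrC subrr scale0r.
Qed.

Fact g6_lie_linearr a b c u : linear (g6_lie a b c u).
Proof.
move=> x v w; rewrite /g6_lie scaler_sumr -big_split; apply: eq_bigr => i _ /=.
rewrite scaler_sumr -big_split; apply: eq_bigr => j _ /=.
by rewrite scalerA -scalerDl !mxE; congr (_ *: _); ring.
Qed.

Lemma g6_lieE a b c (u v : 'rV[K]_6) (k : 'I_6) :
  let m (i j : nat) := u 0 (inord i.-1) * v 0 (inord j.-1)
             - u 0 (inord j.-1) * v 0 (inord i.-1) in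
  g6_lie a b c u v 0 k =
    match k.+1 with
    | 2%N => m 1 3 + a * m 4 5 + b * m 4 6 + c * m 5 6
    | 3%N => m 1 4 + a * m 4 6 + b * m 5 6
    | 4%N => m 1 5 + a * m 5 6
    | 5%N => m 1 6
    | _ => 0
    end.
Proof.
move=> m; rewrite /g6_lie.
transitivity (\sum_(i < 6) \sum_(j < 6 | (i < j)%N)
    m i.+1 j.+1 * g6_table a b c i.+1 j.+1 0 k).
  rewrite summxE; apply: eq_bigr => i _; rewrite summxE; apply: eq_bigr => j _.
  by rewrite mxE /m /= !inord_val.
under eq_bigr do rewrite big_mkcond.
rewrite !big_ord_recl !big_ord0 /= !mxE /g6_e -!val_eqE /= !inordK //.
case: k => -[|[|[|[|[|[|]]]]]] //= _; rewrite /bump /=; ring.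
Qed.

Fact g6_lie_jacobi a b c u v w :
  g6_lie a b c u (g6_lie a b c v w) + g6_lie a b c v (g6_lie a b c w u)
    + g6_lie a b c w (g6_lie a b c u v) = 0.
Proof.
apply/rowP => k; rewrite !mxE !g6_lieE !inordK //=.
by case: k => -[|[|[|[|[|[|]]]]]] //= _; ring.
Qed.

Definition g6_space a b c : Type := 'rV[K]_6.
HB.instance Definition _ a b c := Vector.on (g6_space a b c).
HB.instance Definition _ a b c :=
  Vector_isLieAlgebra.Build K (g6_space a b c) (g6_lie_linearl a b c)
    (g6_lie_linearr a b c) (g6_liexx a b c) (g6_lie_jacobi a b c).

Definition g6 a b c : lieAlgType K := g6_space a b c.

End G6.

(* Main.v *)
Require Import Defs.
From HB Require Import structures.
From mathcomp Require Import all_boot all_order all_algebra.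
From mathcomp Require Import ring.

Set Implicit Arguments.
Unset Strict Implicit.
Unset Printing Implicit Defensive.

Import GRing.Theory.

Local Open Scope ring_scope.

(** The proof has three independent parts, none of which uses more than the
    field axioms, so that small fields and all characteristics are covered.

    Every six-dimensional filiform algebra L, with lower central series C k,
    is isomorphic to some g6 a b c ([filiform6_isotopic_g6]).  The elements x
    with [x, C 2] inside C 4, and those with [x, C 4] = 0, form two proper
    subspaces; an additive group is never the union of two proper subgroups,
    so some e1 lies outside of both ([generic_element]).  As [L, C 4] is a
    line, a second generator e6 can be corrected by a multiple of e1 so that
    it kills C 4.  Then e5, e4, e3, e2 are the successive images of e6 under
    ad e1, and the Jacobi identity computes all the other brackets from
    [e5, e6].

    The parameters are then normalized by isotopisms with f = g
    ([g6_normal_form]).  A shear removes c as soon as a or b is nonzero, and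
    diagonal maps multiply (a, b, c) by (t r^3, t r^4, t r^5), which makes the
    remaining nonzero parameters equal to 1.

    The five normal forms are told apart by the vanishing of a, of b, and of
    the triple (a, b, c) ([isotopic_g6_zeros]).  An isotopism preserves the
    rank of ad u, hence, for all k and d, the property that the elements u
    with ad u of rank at most k lie in a common subspace of dimension at most
    d ([low_rank_within_isotopic]).  For g6 a b c, in the coordinates u1..u6
    of u:
    - for k = 3 the hyperplane u1 = a u6 always has small rank, and so does
      e6; for nonzero a these generate everything, while for a = 0 small rank
      forces u1 = 0;
    - for k = 2 the hyperplane u1 = a u6 has small rank if b = 0, while for
      nonzero b small rank forces u1 = u6 = 0;
    - for k = 1 it has small rank if a = b = c = 0, while otherwise small rank
      forces u1 = u6 = 0. *)

(** * Brackets and the lower central series *)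

Section Bracket.
Variables (K : fieldType) (L : lieAlgType K).
Implicit Types (u v w x y : L) (U V W : {vspace L}).

Lemma lieDl u v w : lie (u + v) w = lie u w + lie v w.
Proof. by have := lie_linearl w 1 u v; rewrite !scale1r. Qed.

Lemma lieDr u v w : lie u (v + w) = lie u v + lie u w.
Proof. by have := lie_linearr u 1 v w; rewrite !scale1r. Qed.

Lemma lieNl u v : lie (- u) v = - lie u v.
Proof. by rewrite -scaleN1r lieZl scaleN1r. Qed.

Lemma lieNr u v : lie u (- v) = - lie u v.
Proof. by rewrite -scaleN1r lieZr scaleN1r. Qed.

Lemma lieC u v : lie u v = - lie v u.
Proof.
apply/eqP; rewrite -addr_eq0; apply/eqP.
by have := liexx (u + v); rewrite lieDl !lieDr !liexx addr0 add0r.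
Qed.

(** The form in which the Jacobi identity is used: ad u is a derivation. *)
Lemma lie_deriv u v w : lie u (lie v w) = lie (lie u v) w + lie v (lie u w).
Proof.
have /eqP := lie_jacobi u v w; rewrite -addrA addr_eq0 => /eqP ->.
by rewrite opprD addrC (lieC (lie u v)) (lieC u w) lieNr.
Qed.

Lemma lie_sum_lt n (p q : 'I_n -> K) (X : 'I_n -> L) :
  lie (\sum_i p i *: X i) (\sum_i q i *: X i) =
  \sum_(i < n) \sum_(j < n | (i < j)%N)
    (p i * q j - p j * q i) *: lie (X i) (X j).
Proof.
rewrite lie_suml.
under eq_bigr => i _.
  rewrite lie_sumr (bigID (fun j : 'I_n => (i < j)%N)) /=.
  rewrite [X in _ + X](bigID (fun j : 'I_n => j == i)) /=.
  rewrite [X in _ + (X + _)]big1 ?add0r; last first.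
    by move=> j /andP[_ /eqP ->]; rewrite lieZl lieZr liexx !scaler0.
  over.
rewrite big_split /= [X in _ + X](exchange_big_dep xpredT) //= -big_split.
apply: eq_bigr => i _ /=.
rewrite [X in _ + X](eq_bigl (fun j : 'I_n => (i < j)%N)); last first.
  by move=> j; rewrite -leqNgt ltn_neqAle andbC.
rewrite -big_split; apply: eq_bigr => j _ /=.
by rewrite !lieZl !lieZr !scalerA (lieC (X j)) scalerN scalerBl.
Qed.

HB.instance Definition _ u :=
  GRing.isLinear.Build K L L _ (lie u) (lie_linearr u).

Notation C := (@lower_central K L).

Lemma mem_lieL U V u v : u \in U -> v \in V -> lie u v \in lie_prodv U V.
Proof. by move=> uU vV; apply: (lie_prodvP U V _ (subvv _)). Qed.

Lemma lie_prodvPn U V W : ~~ (lie_prodv U V <= W)%VS ->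
  exists u v, [/\ u \in U, v \in V & lie u v \notin W].
Proof.
move=> nW; have /allPn[_ /allpairsP[[u v] /= [uU vV ->]] uvW] :
    ~~ all (mem W) [seq lie u v | u <- vbasis U, v <- vbasis V].
  by apply: contra nW => /allP sW; apply/span_subvP.
by exists u, v; split=> //; exact: vbasis_mem.
Qed.

Lemma lower_centralS k : (0 < k)%N -> C k.+1 = lie_prodv (C k) fullv.
Proof. by case: k. Qed.

Lemma lower_central_mono k : (C k.+1 <= C k)%VS.
Proof.
case: k => [|k]; first exact: subvv.
elim: k => [|k IH]; first exact: subvf.
apply/lie_prodvP => u v uC vL; rewrite lower_centralS //.
by rewrite mem_lieL // (subvP IH).
Qed.

Lemma lower_central_le i j : (i <= j)%N -> (C j <= C i)%VS.
Proof.
move/subnK <-; elim: (j - i)%N => [|k IH]; first exact: subvv.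
exact: subv_trans (lower_central_mono _) IH.
Qed.

(** Induction on j, the Jacobi identity moving one factor of [C j, L] at a time
    to the side of u. *)
Lemma lower_central_lie i j u v : (0 < i)%N -> (0 < j)%N ->
  u \in C i -> v \in C j -> lie u v \in C (i + j).
Proof.
move=> i0; case: j => // j _; elim: j => [|j IH] in i i0 u v *.
  by move=> uC vC; rewrite addn1 lower_centralS // mem_lieL // memvf.
move=> uC vC.
suff /subvP/(_ v vC) : (C j.+2 <= linfun (lie u) @^-1: C (i + j.+2))%VS.
  by rewrite -memv_preim lfunE.
rewrite lower_centralS //; apply/lie_prodvP => v1 w v1C _.
rewrite -memv_preim lfunE /= lie_deriv rpredD //.
  by rewrite addnS lower_centralS ?addnS // mem_lieL ?memvf // -addnS IH.
rewrite lieC rpredN -addSnnS IH //.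
by rewrite lower_centralS // mem_lieL ?memvf.
Qed.

End Bracket.

(** * Recognizing g6 from the brackets of a basis *)

Section Frame.
Variables (K : fieldType) (L : lieAlgType K).

Definition frame_map n (X : n.-tuple L) (r : 'rV[K]_n) : L :=
  \sum_(i < n) r 0 i *: X`_i.

Fact frame_map_linear n (X : n.-tuple L) : linear (frame_map X).
Proof.
move=> x r s; rewrite /frame_map scaler_sumr -big_split; apply: eq_bigr => i _.
by rewrite !mxE scalerDl scalerA.
Qed.

HB.instance Definition _ n (X : n.-tuple L) :=
  GRing.isLinear.Build K 'rV[K]_n L _ (frame_map X) (frame_map_linear X).

Lemma frame_map_bij n (X : n.-tuple L) :
  basis_of fullv X -> bijective (frame_map X).
Proof.
move=> bX; exists (fun v => \row_i coord X i v) => [r|v].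
  by apply/rowP => i; rewrite mxE coord_sum_free // (basis_free bX).
rewrite /frame_map [RHS](coord_basis bX) ?memvf //.
by apply: eq_bigr => i _; rewrite mxE.
Qed.

Lemma frame_map_g6_e (X : 6.-tuple L) k :
  (0 < k <= 6)%N -> frame_map X (g6_e K k) = X`_k.-1.
Proof.
case: k => // k k6; rewrite /frame_map (bigD1 (inord k)) //= big1 => [|i ik].
  by rewrite !mxE !eqxx scale1r addr0 inordK.
by rewrite !mxE (negPf ik) scale0r.
Qed.

Lemma isotopic_g6_frame (a b c : K) (X : 6.-tuple L) :
  basis_of fullv X ->
  (forall i j, (i < j < 6)%N ->
    lie X`_i X`_j = frame_map X (g6_table a b c i.+1 j.+1)) ->
  isotopic L (g6 a b c).
Proof.
move=> bX lieX; apply: isotopic_sym.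
pose f : {linear g6 a b c -> L} := frame_map X.
have fb : bijective f by apply: frame_map_bij.
exists f, f, f; split=> // u v.
rewrite [RHS](_ : _ = frame_map X (g6_lie a b c u v)) // /f /= /frame_map
  lie_sum_lt.
rewrite -/(frame_map X _) linear_sum; apply: eq_bigr => i _.
rewrite linear_sum; apply: eq_bigr => j ij.
by rewrite linearZ_LR /= lieX // ij ltn_ord.
Qed.

End Frame.

(** * Adapted bases of six-dimensional filiform algebras *)

Section Filiform.
Variables (K : fieldType) (L : lieAlgType K).

Notation C := (@lower_central K L).

Lemma dim_add_line (U : {vspace L}) z :
  z \notin U -> \dim (<[z]> + U) = (\dim U).+1.
Proof.
move=> zU; rewrite dimv_disjoint_sum ?dim_vline; last first.
  apply/eqP; rewrite -subv0; apply/subvP => w; rewrite memv_cap => /andP[].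
  case/vlineP=> k ->; have [->|k0] := eqVneq k 0; first by move=> _;
    rewrite scale0r mem0v.
  by rewrite rpredZeq (negPf k0) (negPf zU).
by case: eqVneq zU => [->|]; rewrite ?mem0v.
Qed.

Lemma add_line_dimS (U V : {vspace L}) z :
  (U <= V)%VS -> \dim V = (\dim U).+1 -> z \in V -> z \notin U ->
  V = (<[z]> + U)%VS.
Proof.
move=> UV dV zV zU; apply/esym/eqP; rewrite eqEdim subv_add -memvE zV UV /= dV.
by rewrite dim_add_line.
Qed.

Lemma free_cons_mem (z : L) s (U : {vspace L}) :
  {subset s <= U} -> z \notin U -> free s -> free (z :: s).
Proof.
move=> sU zU fs; rewrite free_cons fs andbT.
by apply: contra zU; apply: subvP; apply/span_subvP.
Qed.

Hypotheses (dimL : \dim {:L} = 6%N) (filL : filiform L).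

Let dimC k : (2 <= k <= 6)%N -> \dim (C k) = (6 - k)%N.
Proof. by move=> k6; rewrite filL dimL. Qed.

Let C6 u : u \in C 6 -> u = 0.
Proof.
by have /eqP := @dimC 6 isT; rewrite dimv_eq0 => /eqP ->; rewrite memv0 => /eqP.
Qed.

Let CS k u : u \in C k.+1 -> u \in C k.
Proof. exact: (subvP (lower_central_mono L k)). Qed.

Let Clie x k u : (0 < k)%N -> u \in C k -> lie x u \in C k.+1.
Proof. by move=> k0; apply: (@lower_central_lie _ _ 1 k) => //;
  exact: memvf. Qed.

Let C_line k z : (2 <= k <= 5)%N -> z \in C k -> z \notin C k.+1 ->
  forall u, u \in C k -> exists t, exists2 w, w \in C k.+1 & u = t *: z + w.
Proof.
move=> /andP[k2 k5] zk zk1 u.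
rewrite (add_line_dimS (lower_central_mono L k) _ zk zk1).
  by case/memv_addP => _ /vlineP[t ->] [w wC ->]; exists t, w.
by rewrite !dimC ?k2 ?(leqW k5) ?k5 ?(leqW k2) // subSS subSn.
Qed.

(** Witnesses p for the first condition and q for the second exist since
    C 3 and C 5 are larger than C 4 and C 6.  If neither works for both
    conditions, then p + q does. *)
Lemma generic_element : exists x,
  (exists2 u, u \in C 2 & lie x u \notin C 4) /\
  (exists2 u, u \in C 4 & lie x u != 0).
Proof.
have ex k : k \in [:: 2; 4]%N ->
    exists x, exists2 u, u \in C k & lie x u \notin C k.+2.
  rewrite !inE => k24; have : ~~ (lie_prodv (C k) fullv <= C k.+2)%VS.
    by case/pred2P: k24 => ->; rewrite -lower_centralS //;
       apply/negP => /dimvS; rewrite !dimC.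
  case/lie_prodvPn => u [v [uC _ uvC]]; exists v, u => //.
  by rewrite lieC rpredN.
have [p [u2 u2C pu2]] := ex 2 isT; have [q [u4 u4C qu4]] := ex 4 isT.
have {}qu4 : lie q u4 != 0 by apply: contra qu4 => /eqP ->; exact: mem0v.
have [pu4|pu4] := eqVneq (lie p u4) 0; last by exists p; split;
  [exists u2|exists u4].
have [qu2|qu2] := boolP (lie q u2 \in C 4); last by exists q; split;
  [exists u2|exists u4].
exists (p + q); split; [exists u2|exists u4] => //; rewrite lieDl.
  by rewrite rpredDr.
by rewrite pu4 add0r.
Qed.

(** The basis is e1 = x, then e6, and the chain e5, e4, e3, e2 of its images
    under ad x.  That no image falls one step too low is where the two
    conditions on x enter, for [x, e5] and [x, e3]; for [x, e4] it follows
    from the Jacobi identity, ad e6 acting on C 3 modulo C 5 through ad x. *)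
Lemma filiform6_isotopic_g6 : exists a b c, isotopic L (g6 a b c).
Proof.
have [x [[u2 u2C xu2] [u4 u4C xu4]]] := generic_element.
have xC2 : x \notin C 2.
  by apply: contra xu2 => xC; apply: (@lower_central_lie _ _ 2 2).
have dimx : \dim (<[x]> + C 2)%VS = 5 by rewrite dim_add_line // dimC.
have [w _ wx] : exists2 w, w \in fullv & w \notin (<[x]> + C 2)%VS.
  by apply/subvPn/negP => /dimvS; rewrite dimL dimx.
have u4N5 : u4 \notin C 5.
  by apply: contra xu4 => /(@Clie x 5 _ isT)/C6 ->.
have [t wt] : exists t, lie w u4 = t *: lie x u4.
  have [|||s [r /C6 -> ->]] := @C_line 5 (lie x u4) isT _ _ (lie w u4).
  - exact: Clie.
  - by apply: contra xu4 => /C6 ->.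
  - exact: Clie.
  by exists s; rewrite addr0.
(* As [L, C 4] is spanned by [x, u4], subtracting t x makes w kill C 4. *)
pose e6 := w - t *: x.
have e6C4 u : u \in C 4 -> lie e6 u = 0.
  case/(@C_line 4 _ isT u4C u4N5) => s [r rC ->].
  rewrite lieDr (C6 (@Clie _ 5 _ isT rC)) addr0.
  by rewrite lieZr /e6 lieDl lieNl lieZl wt subrr scaler0.
have e6x : e6 \notin (<[x]> + C 2)%VS.
  apply: contra wx => e6C; rewrite -(subrK (t *: x) w) memvD //.
  by rewrite memvZ // (subvP (addvSl _ _)) // memv_line.
clearbody e6; clear w wx wt t.
have Ldec u : exists p q, exists2 w, w \in C 2 & u = p *: e6 + q *: x + w.
  have : u \in (<[e6]> + (<[x]> + C 2))%VS.
    by rewrite -(add_line_dimS (subvf _) _ (memvf _) e6x) ?memvf // dimL dimx.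
  case/memv_addP => _ /vlineP[p ->].
  case=> _ /memv_addP[_ /vlineP[q ->] [w wC ->]] ->.
  by exists p, q, w; rewrite ?addrA.
pose e5 := lie x e6; pose e4 := lie x e5; pose e3 := lie x e4;
  pose e2 := lie x e3.
have e5C : e5 \in C 2 by apply: Clie => //; apply: memvf.
have e4C : e4 \in C 3 by exact: Clie.
have e3C : e3 \in C 4 by exact: Clie.
have e2C : e2 \in C 5 by exact: Clie.
have e5N : e5 \notin C 3.
  apply/negP => e5C3; have : (C 2 <= C 3)%VS; last by move/dimvS; rewrite !dimC.
  apply/lie_prodvP => u v _ _.
  have [p [q [r rC ->]]] := Ldec u; have [p' [q' [s sC ->]]] := Ldec v.
  rewrite lieDr; apply: rpredD; last exact: Clie.
  rewrite lieDl; apply: rpredD; last by rewrite lieC rpredN Clie.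
  rewrite !lieDl !lieDr !lieZl !lieZr !liexx (lieC e6) -/e5.
  by rewrite !(rpredD, rpredN, rpredZ, rpred0).
have e4N : e4 \notin C 4.
  apply: contra xu2 => e4C4;
    have [s [r rC ->]] := @C_line 2 _ isT e5C e5N _ u2C.
  by rewrite lieDr lieZr memvD ?memvZ // Clie.
(* If [x, e4] were in C 5, then both ad x and ad e6 would map C 3 to C 5, so
   that C 4 would lie in C 5. *)
have e3N : e3 \notin C 5.
  apply/negP => e3C5.
  have xC3 u : u \in C 3 -> lie x u \in C 5.
    case/(@C_line 3 _ isT e4C e4N) => s [r rC ->].
    by rewrite lieDr lieZr memvD ?memvZ // Clie.
  have : (C 4 <= C 5)%VS; last by move/dimvS; rewrite !dimC.
  apply/lie_prodvP => u v uC _.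
  have [s [r rC ->]] := @C_line 3 _ isT e4C e4N _ uC.
  rewrite lieDl rpredD //; last by rewrite lieC rpredN Clie.
  rewrite lieZl rpredZ //.
  have [p [q [w wC ->]]] := Ldec v.
  rewrite !lieDr !lieZr !rpredD ?rpredZ //.
  - rewrite lieC rpredN /e4 lie_deriv (lieC e6) -/e5 lieNl liexx oppr0 add0r.
    by rewrite xC3 // Clie.
  - by rewrite lieC rpredN xC3.
  exact: (@lower_central_lie _ _ 3 2).
have e2N : e2 != 0.
  apply: contra xu4 => /eqP e20;
    have [s [r rC ->]] := @C_line 4 _ isT e3C e3N _ u4C.
  by rewrite lieDr lieZr -/e2 e20 scaler0 add0r (C6 (@Clie _ 5 _ isT rC)).
have [a [r4 r4C e56]] : exists a, exists2 w, w \in C 4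
    & lie e5 e6 = a *: e4 + w.
  by apply: (@C_line 3) => //; rewrite lieC rpredN Clie.
have [b [r5 r5C r4E]] := @C_line 4 _ isT e3C e3N _ r4C.
have [c [r6 /C6 r60 r5E]] : exists c, exists2 w, w \in C 6 & r5 = c *: e2 + w.
  by apply: (@C_line 5) => //; apply: contra e2N => /C6 ->.
rewrite {}r60 addr0 in r5E.
rewrite {}r4E {}r5E in e56.
have C7 i j u v : (5 < i.+1 + j.+1)%N -> u \in C i.+1 -> v \in C j.+1 ->
    lie u v = 0.
  move=> ij uC vC; apply: C6; apply: (subvP (lower_central_le L ij)).
  exact: lower_central_lie.
(* Applying ad x to [e5, e6], and again to the result, gives [e4, e6] and then
   [e4, e5]. *)
have e46 : lie e4 e6 = a *: e3 + b *: e2.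
  have := lie_deriv x e5 e6; rewrite -/e5 -/e4 liexx addr0 => <-.
  by rewrite e56 !lieDr !lieZr -/e3 -/e2 (C6 (@Clie x 5 _ isT e2C)) scaler0
    addr0.
have e36 : lie e3 e6 = 0 by rewrite lieC e6C4 ?oppr0.
have e45 : lie e4 e5 = a *: e2.
  have := lie_deriv x e4 e6; rewrite -/e3 -/e5 e36 add0r => <-.
  by rewrite e46 !lieDr !lieZr -/e2 (C6 (@Clie x 5 _ isT e2C)) scaler0 addr0.
exists a, b, c;
  apply: (@isotopic_g6_frame _ _ _ _ _ [tuple x; e2; e3; e4; e5; e6]).
  rewrite basisEfree subvf dimL /= andbT.
  have p : perm_eq [:: x; e2; e3; e4; e5; e6] [:: e6; x; e5; e4; e3; e2].
    by apply/permP => p /=; ring.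
  have e2C4 := CS e2C; have e3C3 := CS e3C; have e4C2 := CS e4C.
  have e2C3 := CS e2C4; have e3C2 := CS e3C3; have e2C2 := CS e2C3.
  have s2 : {subset [:: e2] <= C 5} by apply/allP; rewrite /= e2C.
  have s3 : {subset [:: e3; e2] <= C 4} by apply/allP; rewrite /= e3C e2C4.
  have s4 : {subset [:: e4; e3; e2] <= C 3}.
    by apply/allP; rewrite /= e4C e3C3 e2C3.
  have s5 : {subset [:: e5; e4; e3; e2] <= C 2}.
    by apply/allP; rewrite /= e5C e4C2 e3C2 e2C2.
  have s6 : {subset [:: x; e5; e4; e3; e2] <= (<[x]> + C 2)%VS}.
    move=> v; rewrite inE => /predU1P[->|/s5].
      by apply: (subvP (addvSl _ _)); exact: memv_line.
    exact: (subvP (addvSr _ _)).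
  rewrite (perm_free p) (free_cons_mem s6) // (free_cons_mem s5) //.
  rewrite (free_cons_mem s4) // (free_cons_mem s3) // (free_cons_mem s2) //.
  by rewrite seq1_free.
case=> [|[|[|[|[|[|i]]]]]] [|[|[|[|[|[|j]]]]]] //= ij;
  rewrite ?linearD ?linearZ ?linear0 /= ?frame_map_g6_e //=.
- by apply: (@C7 0 4) => //; exact: memvf.
- exact: (@C7 4 3).
- exact: (@C7 4 2).
- exact: (@C7 4 1).
- by apply: (@C7 4 0) => //; exact: memvf.
- exact: (@C7 3 2).
- exact: (@C7 3 1).
- by rewrite addrC.
- by rewrite e56 addrC (addrC (b *: e3)).
- by case/andP: ij.
Qed.

End Filiform.

(** * Filiformity of g6 *)

Section G6Filiform.
Variable K : fieldType.

Lemma row_span_coord0 n (s : seq 'rV[K]_n) (l : 'I_n) :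
  {in s, forall w : 'rV[K]_n, w 0 l = 0} ->
  forall u, u \in <<s>>%VS -> u 0 l = 0.
Proof.
move=> s0 u /(coord_span (X := in_tuple s)) ->; rewrite summxE big1 // => i _.
by rewrite mxE s0 ?mulr0 // mem_nth.
Qed.

Lemma free_cons_row n (z : 'rV[K]_n) s (l : 'I_n) :
  z 0 l != 0 -> {in s, forall w : 'rV[K]_n, w 0 l = 0} -> free s ->
  free (z :: s).
Proof.
move=> zl s0 fs; rewrite free_cons fs andbT; apply: contra zl => zs.
by rewrite (row_span_coord0 s0 zs).
Qed.

Definition g6_span (s : seq nat) : {vspace 'rV[K]_6} :=
  <<[seq g6_e K k | k <- s]>>%VS.

Lemma g6_spanP s (u : 'rV_6) : (forall k, k \in s -> (0 < k <= 6)%N) ->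
  reflect (forall l : 'I_6, l.+1 \notin s -> u 0 l = 0) (u \in g6_span s).
Proof.
move=> s6; apply: (iffP idP) => [us l ls|u0].
  apply: row_span_coord0 us => _ /mapP[k ks ->].
  by rewrite g6_eE ?s6 //; case: eqP ls => // ->; rewrite ks.
rewrite (row_sum_delta u); apply: rpred_sum => l _.
have [ls|/u0 ->] := boolP (l.+1 \in s); last by rewrite scale0r mem0v.
apply/rpredZ/memv_span/mapP; exists l.+1 => //.
by rewrite /g6_e /= inord_val.
Qed.

Lemma dim_g6_span s : (forall k, k \in s -> (0 < k <= 6)%N) -> uniq s ->
  \dim (g6_span s) = size s.
Proof.
move=> s6 us; rewrite -(size_map (g6_e K)); apply/eqP.
elim: s => [|k s IH] /= in s6 us *; first by rewrite /g6_span span_nil dimv0.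
case/andP: us => ks us.
have s6' : (forall k, k \in s -> (0 < k <= 6)%N).
  by move=> j js; apply: s6; rewrite inE js orbT.
have k6 : (0 < k <= 6)%N by apply: s6; rewrite inE eqxx.
apply: (free_cons_row (l := inord k.-1)); last exact: IH.
  by rewrite g6_eE // inordK; case: k k6 {ks s6} => //= k _;
    rewrite eqxx oner_eq0.
move=> _ /mapP[j js ->]; rewrite g6_eE ?s6' // inordK; last first.
  by case: k k6 {ks s6}.
by rewrite prednK; [case: eqP ks => // ->; rewrite js | case/andP: k6].
Qed.

Lemma dim_g6 (a b c : K) : \dim {: g6 a b c} = 6%N.
Proof. by rewrite dimvf. Qed.

Lemma g6_span_iota_range m k : (m <= 4)%N -> k \in iota 2 m -> (0 < k <= 6)%N.
Proof.
move=> m4; rewrite mem_iota => /andP[k2 km].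
by rewrite (ltn_trans _ k2) // (leq_trans (ltnW km)) // !ltnS.
Qed.

Lemma g6_span_iotaP m (u : 'rV_6) : (m <= 4)%N ->
  reflect (forall l : 'I_6, ~~ (0 < l <= m)%N -> u 0 l = 0)
    (u \in g6_span (iota 2 m)).
Proof.
move=> m4; apply: (iffP (g6_spanP _ (fun k => @g6_span_iota_range m k m4))) =>
  u0 l lm; apply: u0.
  by rewrite mem_iota !ltnS.
by rewrite mem_iota !ltnS in lm.
Qed.

(** With m = 4 and U the full space, this starts the lower central series of
    g6; with m < 4 and U the span of e_2, ..., e_(m+2), it is the step from one
    term to the next. *)
Lemma g6_lie_prodv (a b c : K) m (U : {vspace g6 a b c}) : (m <= 4)%N ->
  (forall (u : 'rV_6) (l : 'I_6), u \in U -> (m.+1 < l)%N -> u 0 l = 0) ->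
  ((m < 4)%N -> forall u : 'rV_6, u \in U -> u 0 0 = 0) ->
  (forall k, k \in iota 3 m -> g6_e K k \in U) ->
  lie_prodv U fullv = g6_span (iota 2 m).
Proof.
move=> m4 Uhi U0 eU; apply/eqP; rewrite eqEsubv; apply/andP; split; last first.
  apply/span_subvP => w /mapP[k + ->]; rewrite mem_iota => /andP[k2 km].
  have k6 : (k < 6)%N by rewrite (leq_trans km).
  have -> : g6_e K k = lie (- g6_e K k.+1 : g6 a b c) (g6_e K 1 : g6 a b c).
    rewrite lieNl lieC opprK
      [RHS](_ : _ = g6_lie a b c (g6_e K 1) (g6_e K k.+1)) //.
    rewrite g6_lie_e //; last by rewrite /= ltnS ltnW.
    by case: k k2 k6 {km} => [|[|[|[|[|[|k]]]]]].
  apply: mem_lieL; last exact: memvf.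
  by rewrite rpredN eU // mem_iota ltnS k2 addSn.
apply/lie_prodvP => u v uU _; apply/(g6_span_iotaP _ m4) => l lm.
rewrite [LHS](_ : _ = g6_lie a b c u v 0 l) // g6_lieE.
have Uh (k : 'I_6) : (m.+1 < k)%N -> (u : 'rV_6) 0 k = 0 by apply: Uhi.
have U00 (k : 'I_6) : k = 0 -> (m < 4)%N -> (u : 'rV_6) 0 k = 0.
  by move=> -> m3; apply: U0.
have i0 : inord 0 = 0 :> 'I_6 by apply/val_inj; rewrite /= inordK.
clear Uhi U0 eU; case: l lm => -[|[|[|[|[|[|l]]]]]] //= _.
all: case: m m4 Uh U00 => [|[|[|[|[|m]]]]] //= _ Uh U00 lm.
all: rewrite ?(U00 _ i0) // ?Uh ?inordK //.
all: ring.
Qed.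

Lemma lower_central_g6 (a b c : K) k : (2 <= k <= 6)%N ->
  lower_central (g6 a b c) k = g6_span (iota 2 (6 - k)).
Proof.
case: k => [|[|k]] //; elim: k => [|k IH] k4.
  apply: g6_lie_prodv => //.
  - by move=> u [l l6] _ /=; rewrite ltnNge -ltnS l6.
  - by move=> j _; exact: memvf.
rewrite lower_centralS // IH ?(ltnW k4) // !subSS.
have [m [-> -> m3]] : exists m, [/\ 4 - k = m.+1, 3 - k = m & m <= 3]%N.
  by exists (3 - k)%N; rewrite subSn // leq_subr.
have m4 : (m.+1 <= 4)%N by [].
apply: (g6_lie_prodv (ltnW m4)) => [u l /(g6_span_iotaP _ m4) u0 ml|_ u|j].
- by apply: u0; rewrite (leqNgt l) ml andbF.
- by move/(g6_span_iotaP _ m4); apply.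
- rewrite mem_iota => jm; apply/memv_span/map_f; rewrite mem_iota.
  by case/andP: jm => /ltnW -> jm; rewrite addnS.
Qed.

Lemma filiform_g6 (a b c : K) : filiform (g6 a b c).
Proof.
move=> k; rewrite dim_g6 => /[dup] k6 /andP[k2 _].
rewrite lower_central_g6 // dim_g6_span ?iota_uniq ?size_iota // => j.
by apply: g6_span_iota_range; rewrite leq_subLR (leq_add k2 (leqnn 4)).
Qed.

End G6Filiform.

(** * Normalizing the parameters *)

Section Normalization.
Variable K : fieldType.
Implicit Types a b c : K.

Lemma isotopic_g6_mx a b c a' b' c' (P Q : 'M[K]_6) :
  P \in unitmx -> Q \in unitmx ->
  (forall u v, g6_lie a' b' c' (u *m P) (v *m P) = g6_lie a b c u v *m Q) ->
  isotopic (g6 a b c) (g6 a' b' c').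
Proof.
move=> uP uQ PQ.
have bij (M : 'M[K]_6) : M \in unitmx -> bijective (mulmxr M : 'rV_6 -> 'rV_6).
  by move=> uM; exists (mulmxr (invmx M)) => r /=; rewrite (mulmxK, mulmxKV).
pose f : {linear g6 a b c -> g6 a' b' c'} := mulmxr P.
pose h : {linear g6 a b c -> g6 a' b' c'} := mulmxr Q.
by exists f, f, h; split; [exact: bij | exact: bij | exact: bij | exact: PQ].
Qed.

Definition shear n (j k : 'I_n) (t : K) : 'M[K]_n := 1%:M + t *: delta_mx j k.

Lemma shear_unit n (j k : 'I_n) t : j != k -> shear j k t \in unitmx.
Proof.
move=> jk; apply: (proj1 (@mulmx1_unit _ _ _ (shear j k (- t)) _)).
rewrite /shear mulmxDl !mulmxDr !mul1mx !mulmx1 -!scalemxAl -!scalemxAr.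
by rewrite mul_delta_mx_0 1?eq_sym // !scaler0 addr0 scaleNr addrNK.
Qed.

Lemma mul_shear n (j k : 'I_n) t (u : 'rV_n) i :
  (u *m shear j k t) 0 i = u 0 i + t * u 0 j * (i == k)%:R.
Proof.
rewrite mulmxDr mulmx1 -scalemxAr !mxE (bigD1 j) //= big1 => [|l lj].
  by rewrite !mxE eqxx addr0 mulrA.
by rewrite !mxE (negPf lj) mulr0.
Qed.

(** The shear f adds - (c / a) e3 to e5.  This changes only the e2-coordinate
    of the bracket [e1, e5], by - c / a, while h adds - (c / a) e2 to e4, which
    makes up for that change and takes c off [e5, e6], as e4 occurs there with
    coefficient a. *)
Lemma g6_drop_c_of_a a b c : a != 0 -> isotopic (g6 a b c) (g6 a b 0).
Proof.
move=> a0.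
apply: (@isotopic_g6_mx _ _ _ _ _ _ (shear (inord 4) (inord 2) (- (c / a)))
                                    (shear (inord 3) (inord 1) (- (c / a)))).
- by rewrite shear_unit // -val_eqE /= !inordK.
- by rewrite shear_unit // -val_eqE /= !inordK.
move=> u v; apply/rowP => l; rewrite mul_shear !g6_lieE !mul_shear.
rewrite -!val_eqE /= !inordK //; case: l => -[|[|[|[|[|[|l]]]]]] //= _;
  by field.
Qed.

(** The shear f adds (c / b) e4 to e5, so that b in [e4, e6] supplies the c of
    [e5, e6]; h corrects [e1, e5]. *)
Lemma g6_drop_c_of_b b c : b != 0 -> isotopic (g6 0 b c) (g6 0 b 0).
Proof.
move=> b0.
apply: (@isotopic_g6_mx _ _ _ _ _ _ (shear (inord 4) (inord 3) (c / b))
                                    (shear (inord 3) (inord 2) (c / b))).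
- by rewrite shear_unit // -val_eqE /= !inordK.
- by rewrite shear_unit // -val_eqE /= !inordK.
move=> u v; apply/rowP => l; rewrite mul_shear !g6_lieE !mul_shear.
rewrite -!val_eqE /= !inordK //; case: l => -[|[|[|[|[|[|l]]]]]] //= _;
  by field.
Qed.

(** The weights of e3, ..., e6 under f form a geometric progression, so that a
    and b, which occur in several brackets, are scaled alike in all of them; h
    multiplies [e1, e_k] by the weight of e_k.  The weight of e2 under f and
    those of e1 and e6 under h are free, e2 being central and [L, L] being
    spanned by e2, ..., e5. *)
Lemma g6_scale a b c t r : t != 0 -> r != 0 ->
  isotopic (g6 (a * (t * r ^+ 3)) (b * (t * r ^+ 4)) (c * (t * r ^+ 5)))
           (g6 a b c).
Proof.
move=> t0 r0.
pose diag (s : seq K) : 'M_6 := diag_mx (\row_i s`_i).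
have diag_unit (s : seq K) : size s = 6%N -> all (predC1 0) s ->
    diag s \in unitmx.
  move=> s6 /allP s0; rewrite unitmxE det_diag unitfE; apply/prodf_neq0 => i _.
  by rewrite mxE; apply: s0; rewrite mem_nth ?s6.
have mul_diag s (u : 'rV_6) i : (u *m diag s) 0 i = u 0 i * s`_i.
  by rewrite mul_mx_diag !mxE.
apply: (@isotopic_g6_mx _ _ _ _ _ _
  (diag [:: 1; 1; t; t * r; t * r ^+ 2; t * r ^+ 3])
  (diag [:: 1; t; t * r; t * r ^+ 2; t * r ^+ 3; 1])).
- by rewrite diag_unit //= !(mulf_eq0, expf_eq0, oner_eq0) (negPf t0)
    (negPf r0).
- by rewrite diag_unit //= !(mulf_eq0, expf_eq0, oner_eq0) (negPf t0)
    (negPf r0).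
move=> u v; apply/rowP => l; rewrite mul_diag !g6_lieE !mul_diag.
rewrite !inordK //; case: l => -[|[|[|[|[|[|l]]]]]] //= _; ring.
Qed.

Definition g6_params : 5.-tuple (K * K * K) :=
  [tuple (0, 0, 0); (0, 0, 1); (0, 1, 0); (1, 0, 0); (1, 1, 0)].

Definition g6_rep (i : 'I_5) : lieAlgType K :=
  let: (a, b, c) := tnth g6_params i in g6 a b c.

Lemma g6_normal_form a b c : exists i, isotopic (g6 a b c) (g6_rep i).
Proof.
have scale a1 b1 c1 a' b' c' t r : t != 0 -> r != 0 ->
    a1 = a' * (t * r ^+ 3) -> b1 = b' * (t * r ^+ 4) ->
    c1 = c' * (t * r ^+ 5) -> isotopic (g6 a1 b1 c1) (g6 a' b' c').
  by move=> t0 r0 -> -> ->; exact: (g6_scale a' b' c' t0 r0).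
have [->|a0] := eqVneq a 0.
  have [->|b0] := eqVneq b 0.
    have [->|c0] := eqVneq c 0; first by exists (@Ordinal 5 0 isT);
      exact: isotopic_refl.
    exists (@Ordinal 5 1 isT).
    by apply: (scale _ _ _ _ _ _ c 1);
      rewrite ?oner_neq0 ?expr1n ?mul0r ?mul1r ?mulr1.
  exists (@Ordinal 5 2 isT); apply: isotopic_trans (g6_drop_c_of_b c b0) _.
  by apply: (scale _ _ _ _ _ _ b 1);
    rewrite ?oner_neq0 ?expr1n ?mul0r ?mul1r ?mulr1.
have [->|b0] := eqVneq b 0.
  exists (@Ordinal 5 3 isT); apply: isotopic_trans (g6_drop_c_of_a 0 c a0) _.
  by apply: (scale _ _ _ _ _ _ a 1);
    rewrite ?oner_neq0 ?expr1n ?mul0r ?mul1r ?mulr1.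
exists (@Ordinal 5 4 isT); apply: isotopic_trans (g6_drop_c_of_a b c a0) _.
(* The solution of t r^3 = a and t r^4 = b. *)
apply: (scale _ _ _ _ _ _ (a ^+ 4 / b ^+ 3) (b / a)).
- by rewrite mulf_neq0 ?invr_neq0 ?expf_neq0.
- by rewrite mulf_neq0 ?invr_neq0.
- by field; rewrite a0 b0.
- by field; rewrite a0 b0.
- by rewrite mul0r.
Qed.

End Normalization.

(** * The rank of ad u *)

Section AdRank.
Variable K : fieldType.
Implicit Types L : lieAlgType K.

Definition ad_rank L (u : L) := \dim (lie_prodv <[u]> fullv).

(** A subspace W that contains the elements of small rank is asked for, since
    these elements need not form a subspace themselves. *)
Definition low_rank_within L k d := exists2 W : {vspace L},
  (\dim W <= d)%N & forall u : L, (ad_rank u <= k)%N -> u \in W.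

Lemma lie_mem_line L (u v : L) : lie u v \in lie_prodv <[u]> fullv.
Proof. by apply: mem_lieL; [exact: memv_line | exact: memvf]. Qed.

Lemma lie_line_sub L (u : L) (W : {vspace L}) :
  (forall v, lie u v \in W) -> (lie_prodv <[u]> fullv <= W)%VS.
Proof.
by move=> uW; apply/lie_prodvP => _ v /vlineP[t ->] _; rewrite lieZl rpredZ.
Qed.

Lemma ad_rank_le L (u : L) s :
  (forall v, lie u v \in <<s>>%VS) -> (ad_rank u <= size s)%N.
Proof. by move=> us; apply: leq_trans (dim_span s);
  apply/dimvS/lie_line_sub. Qed.

Lemma ad_rank_ge L (u : L) s : free s ->
  (forall w, w \in s -> exists v, w = lie u v) -> (size s <= ad_rank u)%N.
Proof.
move=> /eqP <- us; apply/dimvS/span_subvP => w /us[v ->].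
exact: lie_mem_line.
Qed.

Lemma dim_limg_inj L L' (f : {linear L -> L'}) (U : {vspace L}) :
  injective f -> \dim (linfun f @: U) = \dim U.
Proof.
move=> fi; apply/limg_dim_eq/eqP; rewrite -subv0; apply/subvP => u.
rewrite memv_cap memv_ker lfunE /= memv0 => /andP[_ /eqP fu].
by apply/eqP/fi; rewrite fu linear0.
Qed.

(** From [f u, g v] = h [u, v], the range of ad (f u) is the image under h of
    that of ad u, so f maps elements of small rank to elements of small rank. *)
Lemma low_rank_within_isotopic L L' k d :
  isotopic L L' -> low_rank_within L k d -> low_rank_within L' k d.
Proof.
move=> [f [g [h [[f' fK f'K] [g' gK g'K] bh fgh]]]] [W dW LW].
exists (linfun f @: W)%VS => [|u' u'k].
  by rewrite dim_limg_inj //; exact: can_inj fK.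
rewrite -(f'K u') -[f _](lfunE f) memv_img // LW //.
rewrite /ad_rank -(dim_limg_inj _ (bij_inj bh)); apply: leq_trans u'k.
apply/dimvS/subvP => _ /memv_imgP[w wu ->].
rewrite lfunE /=.
have : (lie_prodv <[f' u']> fullv
        <= linfun h @^-1: lie_prodv <[u']> fullv)%VS.
  apply: lie_line_sub => v; rewrite -memv_preim lfunE /= -fgh f'K.
  exact: lie_mem_line.
by move/subvP/(_ w wu); rewrite -memv_preim lfunE.
Qed.

End AdRank.

(** * Elements of small rank in g6 *)

Section Invariants.
Variables (K : fieldType) (a b c : K).

(* Coordinates are numbered from 0: u`_(k) goes with the vector e (k + 1). *)
Local Notation e := (g6_e K).
Local Notation "u '`_(' k ')'" := ((u : 'rV[K]_6) 0 (inord k%N)) (at level 2).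

Lemma g6_lie_brE (u v : g6 a b c) : lie u v = g6_lie a b c u v.
Proof. by []. Qed.

Lemma g6_e_entry k j : (0 < k <= 6)%N -> (j < 6)%N ->
  (e k)`_(j) = (j.+1 == k)%:R.
Proof. by move=> k6 j6; rewrite g6_eE // inordK. Qed.

Lemma free_triangular (s : seq ('rV[K]_6 * nat)) :
  all (fun p => p.1`_(p.2) != 0) s ->
  pairwise (fun p q => q.1`_(p.2) == 0) s -> free [seq p.1 | p <- s].
Proof.
elim: s => [|[w l] s IH] /=; first by rewrite nil_free.
case/andP=> wl s0 /andP[/allP sl sp]; apply: free_cons_row wl _ (IH s0 sp).
by move=> _ /mapP[q qs ->]; apply/eqP/sl.
Qed.

(** Each pair (k, l) in s names the bracket [u, e_k] and a coordinate of it
    that vanishes in the later brackets. *)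
Lemma g6_ad_rank_ge (u : g6 a b c) (s : seq (nat * nat)) :
  all (fun p => (g6_lie a b c u (e p.1))`_(p.2) != 0) s ->
  pairwise (fun p q => (g6_lie a b c u (e q.1))`_(p.2) == 0) s ->
  (size s <= ad_rank u)%N.
Proof.
move=> s0 sp; rewrite -(size_map (fun p => g6_lie a b c u (e p.1))).
apply: ad_rank_ge => [|w /mapP[p _ ->]]; last by exists (e p.1).
pose t := [seq (g6_lie a b c u (e p.1), p.2) | p <- s].
rewrite (_ : map _ s = [seq q.1 | q <- t]); last by rewrite -map_comp.
by apply: free_triangular; rewrite ?all_map ?pairwise_map.
Qed.

Lemma g6_lie_coord (u v : 'rV[K]_6) (w := g6_lie a b c u v)
    (m := fun i j : nat => u`_(i) * v`_(j) - u`_(j) * v`_(i)) :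
  (w`_(1) = m 0%N 2%N + a * m 3%N 4%N + b * m 3%N 5%N + c * m 4%N 5%N) *
  (w`_(2) = m 0%N 3%N + a * m 3%N 5%N + b * m 4%N 5%N) *
  (w`_(3) = m 0%N 4%N + a * m 4%N 5%N) * (w`_(4) = m 0%N 5%N).
Proof. by rewrite /w !g6_lieE !inordK. Qed.

Let adE := (g6_lie_coord, g6_e_entry, mulr0, mul0r, mulr1, subr0, sub0r, addr0,
            add0r, oppr0, mulrN, andbT, oppr_eq0, mulf_eq0, negb_or, eqxx,
            subrr, orbT, oner_eq0).

(** In this lemma and the next, u1 - a u6 is the coefficient of v4, v5 in the
    coordinates e3, e4 of [u, v], so it has to vanish first; the remaining
    parameters then act through u6. *)
Lemma g6_ad_rank_le1 (u : g6 a b c) : (a, b, c) != 0 ->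
  (ad_rank u <= 1)%N -> u`_(0) = 0 /\ u`_(5) = 0.
Proof.
move=> abc ru.
have [z0|z] := eqVneq (u`_(0)) (a * u`_(5)); last first.
  suff: (2 <= ad_rank u)%N by rewrite ltnNge ru.
  by apply: (@g6_ad_rank_ge u [:: (5, 3); (4, 2)]%N);
    rewrite /= !adE // subr_eq0 z.
have [u5|u5] := eqVneq (u`_(5)) 0; first by rewrite z0 u5 mulr0.
suff: (2 <= ad_rank u)%N by rewrite ltnNge ru.
have [a0|a0] := eqVneq a 0; last first.
  by apply: (@g6_ad_rank_ge u [:: (1, 4); (3, 1)]%N);
    rewrite /= !adE ?z0 ?(eqxx, adE) // u5 a0.
have [b0|b0] := eqVneq b 0; last first.
  by apply: (@g6_ad_rank_ge u [:: (1, 4); (5, 2)]%N);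
    rewrite /= !adE ?a0 ?(eqxx, adE) // u5 b0.
have c0 : c != 0 by apply: contra abc => /eqP ->; rewrite a0 b0.
by apply: (@g6_ad_rank_ge u [:: (1, 4); (5, 1)]%N);
  rewrite /= !adE ?a0 ?b0 ?(eqxx, adE) // u5 c0.
Qed.

Lemma g6_ad_rank_le2 (u : g6 a b c) : b != 0 ->
  (ad_rank u <= 2)%N -> u`_(0) = 0 /\ u`_(5) = 0.
Proof.
move=> b0 ru.
have [z0|z] := eqVneq (u`_(0)) (a * u`_(5)); last first.
  suff: (3 <= ad_rank u)%N by rewrite ltnNge ru.
  have [u0|u0] := eqVneq (u`_(0)) 0.
    apply: (@g6_ad_rank_ge u [:: (1, 4); (5, 3); (4, 2)]%N);
      rewrite /= !adE // subr_eq0 z.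
    by rewrite !andbT; apply: contra z => /eqP ->; rewrite u0 mulr0.
  by apply: (@g6_ad_rank_ge u [:: (6, 4); (5, 3); (4, 2)]%N);
    rewrite /= !adE // subr_eq0 z u0.
have [u5|u5] := eqVneq (u`_(5)) 0; first by rewrite z0 u5 mulr0.
suff: (3 <= ad_rank u)%N by rewrite ltnNge ru.
have [a0|a0] := eqVneq a 0; last first.
  by apply: (@g6_ad_rank_ge u [:: (1, 4); (5, 2); (3, 1)]%N);
    rewrite /= !adE ?z0 ?(eqxx, adE) // u5 a0 b0.
by apply: (@g6_ad_rank_ge u [:: (1, 4); (5, 2); (4, 1)]%N);
  rewrite /= !adE ?z0 ?a0 ?(eqxx, adE) // u5 b0.
Qed.

Lemma g6_ad_rank_le3 (u : g6 a b c) : a = 0 -> (ad_rank u <= 3)%N -> u`_(0) = 0.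
Proof.
move=> a0 ru; have [//|u0] := eqVneq (u`_(0)) 0.
suff: (4 <= ad_rank u)%N by rewrite ltnNge ru.
by apply: (@g6_ad_rank_ge u [:: (6, 4); (5, 3); (4, 2); (3, 1)]%N);
  rewrite /= !adE ?a0 ?(eqxx, adE) // u0.
Qed.

(** On this hyperplane the brackets, taken modulo e2 and e3, are all multiples
    of [e1, u]. *)
Lemma g6_lie_hyperplane (u v : g6 a b c) : u`_(0) = a * u`_(5) ->
  exists r s t, [/\ lie u v = r *: lie (e 1 : g6 a b c) u
                              + s *: (e 3 : g6 a b c) + t *: (e 2 : g6 a b c),
    b = 0 -> s = 0 & (a, b, c) = 0 -> t = 0].
Proof.
move=> u0; exists (a * v`_(5) - v`_(0)),
  (b * (u`_(4) * v`_(5) - u`_(5) * v`_(4))).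
exists (a * (u`_(5) * v`_(2) - u`_(2) * v`_(5) + u`_(3) * v`_(4)
          - u`_(4) * v`_(3))
        + b * (u`_(3) * v`_(5) - u`_(5) * v`_(3))
        + c * (u`_(4) * v`_(5) - u`_(5) * v`_(4))).
split=> [|->|[-> -> ->]]; try by rewrite !mul0r ?addr0.
rewrite !g6_lie_brE; apply/rowP => l; rewrite !mxE !g6_lieE -!val_eqE /=.
rewrite !inordK // !g6_e_entry // u0.
by case: l => -[|[|[|[|[|[|l]]]]]] //= _; ring.
Qed.

Lemma g6_ad_rank3_e6 : (ad_rank (e 6 : g6 a b c) <= 3)%N.
Proof.
pose s : seq (g6 a b c) := [:: e 5; b *: e 2 + a *: e 3;
                              c *: e 2 + b *: e 3 + a *: e 4].
apply: (@ad_rank_le _ _ _ s) => v.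
have -> : lie (e 6 : g6 a b c) v =
    (- v`_(0)) *: s`_0 + (- v`_(3)) *: s`_1 + (- v`_(4)) *: s`_2.
  rewrite g6_lie_brE; apply/rowP => l; rewrite !mxE !g6_lieE -!val_eqE /=.
  rewrite !inordK // !g6_e_entry //.
  by case: l => -[|[|[|[|[|[|l]]]]]] //= _; ring.
by rewrite !rpredD ?rpredZ ?memv_span ?mem_nth.
Qed.

Lemma g6_ad_rank_hyperplane (u : g6 a b c) : u`_(0) = a * u`_(5) ->
  [/\ (ad_rank u <= 3)%N, b = 0 -> (ad_rank u <= 2)%N
    & (a, b, c) = 0 -> (ad_rank u <= 1)%N].
Proof.
move=> /g6_lie_hyperplane uE; split=> [|b0|abc0].
- apply: (@ad_rank_le _ _ _ [:: lie (e 1 : g6 a b c) u; e 3; e 2]) => v.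
  have [r [s [t [-> _ _]]]] := uE v.
  by rewrite !rpredD ?rpredZ ?memv_span ?inE ?eqxx ?orbT.
- apply: (@ad_rank_le _ _ _ [:: lie (e 1 : g6 a b c) u; e 2]) => v.
  have [r [s [t [-> /(_ b0) -> _]]]] := uE v; rewrite scale0r addr0.
  by rewrite !rpredD ?rpredZ ?memv_span ?inE ?eqxx ?orbT.
- apply: (@ad_rank_le _ _ _ [:: lie (e 1 : g6 a b c) u]) => v.
  have b0 : b = 0 by case: abc0.
  have [r [s [t [-> /(_ b0) -> /(_ abc0) ->]]]] := uE v.
  by rewrite !scale0r !addr0 rpredZ ?memv_span ?inE ?eqxx.
Qed.

Lemma dim_g6_hyperplane (W : {vspace g6 a b c}) :
  (forall u : 'rV_6, u`_(0) = a * u`_(5) -> u \in W) -> (5 <= \dim W)%N.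
Proof.
move=> HW; pose w : 'rV_6 := a *: e 1 + e 6.
have s6 k : k \in iota 2 4 -> (0 < k <= 6)%N by exact: g6_span_iota_range.
have fr : free (w :: [seq e k | k <- iota 2 4]).
  apply: (free_cons_row (l := inord 5)).
  - by rewrite !mxE -!val_eqE /= !inordK //= mulr0 add0r oner_eq0.
  - by move=> _ /mapP[k k4 ->]; rewrite g6_e_entry ?s6 //;
    case: eqP k4 => // <-.
  - by rewrite /free -/(g6_span K _) dim_g6_span ?iota_uniq.
apply: (leq_trans (eq_leq (esym (eqP fr)))); apply/dimvS/span_subvP => v.
rewrite inE => /predU1P[->|].
  by apply: HW; rewrite !mxE -!val_eqE /= !inordK //= !(mulr0, mulr1, addr0,
    add0r).
case/mapP=> k k4 ->; apply: HW; rewrite !g6_e_entry ?s6 //.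
by case: eqP k4 => [<- //|_]; case: eqP => [<- //|_]; rewrite mulr0.
Qed.

Lemma mem_g6_span2345 (u : 'rV[K]_6) :
  u`_(0) = 0 /\ u`_(5) = 0 -> u \in g6_span K (iota 2 4).
Proof.
case=> u0 u5; apply/(g6_span_iotaP _ (leqnn 4)) => l.
rewrite -(inord_val l); case: l => -[|[|[|[|[|[|l]]]]]] //= l6;
  by rewrite inordK.
Qed.

Lemma g6_low_rank1 : low_rank_within (g6 a b c) 1 4 <-> (a, b, c) != 0.
Proof.
split=> [[W dW rW]|abc].
  apply/eqP => abc0; move: dW; rewrite leqNgt => /negP; apply.
  by apply: dim_g6_hyperplane => u /g6_ad_rank_hyperplane[_ _ /(_ abc0)/rW].
exists (g6_span K (iota 2 4)) => [|u /(g6_ad_rank_le1 abc)].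
  by rewrite dim_g6_span ?iota_uniq // => k; exact: g6_span_iota_range.
exact: mem_g6_span2345.
Qed.

Lemma g6_low_rank2 : low_rank_within (g6 a b c) 2 4 <-> b != 0.
Proof.
split=> [[W dW rW]|b0].
  apply/eqP => b0; move: dW; rewrite leqNgt => /negP; apply.
  by apply: dim_g6_hyperplane => u /g6_ad_rank_hyperplane[_ /(_ b0)/rW].
exists (g6_span K (iota 2 4)) => [|u /(g6_ad_rank_le2 b0)].
  by rewrite dim_g6_span ?iota_uniq // => k; exact: g6_span_iota_range.
exact: mem_g6_span2345.
Qed.

Let iota25 k : k \in iota 2 5 -> (0 < k <= 6)%N.
Proof. by rewrite mem_iota => /andP[/ltnW ->]. Qed.

Lemma g6_low_rank3 : low_rank_within (g6 a b c) 3 5 <-> a = 0.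
Proof.
split=> [[W dW rW]|a0].
  apply/eqP; apply: contraLR dW => a0; rewrite -ltnNge.
  have HW (u : 'rV_6) : u`_(0) = a * u`_(5) -> u \in W.
    by move/g6_ad_rank_hyperplane=> [/rW].
  have e6W : (e 6 : g6 a b c) \in W by exact: rW g6_ad_rank3_e6.
  have e1W : (e 1 : g6 a b c) \in W.
    rewrite -[e 1](scalerK a0) rpredZ //.
    rewrite -(addrK (e 6 : g6 a b c) (a *: _)) rpredB // HW //.
    by rewrite !mxE -!val_eqE /= !inordK //= !(mulr0, mulr1, addr0, add0r).
  suff -> : W = fullv by rewrite dim_g6.
  apply/eqP; rewrite eqEsubv subvf; apply/subvP => u _.
  rewrite -(subrK ((u`_(0) - a * u`_(5)) *: (e 1 : g6 a b c)) u).
  rewrite rpredD ?rpredZ // HW // !mxE -!val_eqE /= !inordK //=.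
  by rewrite mulr1 mulr0 subr0 opprB addrC addrNK.
exists (g6_span K (iota 2 5)) => [|u /(g6_ad_rank_le3 a0) u0].
  by rewrite dim_g6_span ?iota_uniq.
apply/g6_spanP => // l; rewrite -(inord_val l).
by case: l => -[|[|[|[|[|[|l]]]]]] //= l6; rewrite inordK.
Qed.

End Invariants.

(** * The classification *)

Lemma isotopic_g6_zeros (K : fieldType) (a b c a' b' c' : K) :
  isotopic (g6 a b c) (g6 a' b' c') ->
  [/\ (a == 0) = (a' == 0), (b == 0) = (b' == 0)
    & ((a, b, c) == 0) = ((a', b', c') == 0)].
Proof.
move=> iso; have iso' := isotopic_sym iso.
have low k d :
    low_rank_within (g6 a b c) k d <-> low_rank_within (g6 a' b' c') k d.
  by split; apply: low_rank_within_isotopic.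
split.
- have [to from] := low 3%N 5%N.
  apply/eqP/eqP => [/(g6_low_rank3 a b c)/to/(g6_low_rank3 a' b' c')|] //.
  by move/(g6_low_rank3 a' b' c')/from/(g6_low_rank3 a b c).
- have [to from] := low 2%N 4%N; apply: negb_inj; apply/idP/idP.
    by move/(g6_low_rank2 a b c)/to/(g6_low_rank2 a' b' c').
  by move/(g6_low_rank2 a' b' c')/from/(g6_low_rank2 a b c).
- have [to from] := low 1%N 4%N; apply: negb_inj; apply/idP/idP.
    by move/(g6_low_rank1 a b c)/to/(g6_low_rank1 a' b' c').
  by move/(g6_low_rank1 a' b' c')/from/(g6_low_rank1 a b c).
Qed.

Theorem proposition3p7 (K : fieldType) :
  let abc : 5.-tuple (K * K * K) :=
    [tuple (0, 0, 0); (0, 0, 1); (0, 1, 0); (1, 0, 0); (1, 1, 0)] in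
  let rep (i : 'I_5) : lieAlgType K :=
    let: (a, b, c) := tnth abc i in g6 a b c in
  [/\ forall i : 'I_5, \dim {: rep i} = 6%N /\ filiform (rep i),
      forall i j : 'I_5, isotopic (rep i) (rep j) -> i = j
    & forall L : lieAlgType K, \dim {: L} = 6%N -> filiform L ->
        exists i : 'I_5, isotopic L (rep i)].
Proof.
move=> abc rep; split=> [i|i j|L dimL filL].
- rewrite /rep; case: (tnth abc i) => [[a b] c].
  by split; [exact: dim_g6 | exact: filiform_g6].
- rewrite /rep /abc !(tnth_nth 0).
  case: i j => -[|[|[|[|[|i]]]]] //= i5 [[|[|[|[|[|j]]]]] //= j5];
    (try by move=> _; exact: val_inj);
    by case/isotopic_g6_zeros; rewrite -?pair_eqE /= ?xpair_eqE ?eqxx ?oner_eq0.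
- have [a [b [c Labc]]] := filiform6_isotopic_g6 dimL filL.
  have [i abci] := g6_normal_form a b c.
  by exists i; apply: isotopic_trans Labc abci.
Qed.
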